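(* Consider the polytope $P = \{ (y,x) \in \mathbb R_+^{E'} \times \mathbb R_+^V : A(y,x) = b \}$. Then the projection $P|_x = \{ x \in \mathbb R_+^V : (y,x) \in P \text{ for some } y \in \mathbb R_+^{E'} \}$ is the polytope $P_{\varrho}(G)$ of indegree vectors of orientations of $G = (V, E)$.
   Context: Let $G=(V,E)$ be a loop-free undirected multigraph, and let $P_{\varrho}(G)$ denote the indegree polytope, i.e., the convex hull in $\mathbb R^V$ of the indegree vectors of all orientations of $G$. Construct the bipartite graph $G' = (V, E; E')$, where $E'$ contains an edge between $e \in E$ and $v \in V$ if $v$ is an endpoint of $e$ in $G$. Let $A_{G'}$ denote the incidence matrix of $G'$ (rows indexed by $V \cup E$, columns by $E'$). Extend the rows of $A_{G'}$ corresponding to $V$ with a $|V| \times |V|$ negated identity matrix, and the rows corresponding to $E$ with a zero matrix (of appropriate size); let $A$ denote the resulting matrix, which is totally unimodular. Let $y \in \mathbb R_+^{E'}$ be the variables corresponding to the columns of $A_{G'}$, and $x \in \mathbb R_+^V$ the variables corresponding to the additional columns. Define $b = (0^V, 1^E)$, i.e., right-hand side $0$ for each row indexed by a vertex and $1$ for each row indexed by an edge. (Thus $A(y,x)=b$ says: for every edge $e=uv$, $y_{eu}+y_{ev}=1$, and for every vertex $v$, $x_v=\sum_{e\ni v} y_{ev}$.) *)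

(* Defs.v *)
From mathcomp Require Import all_boot all_order all_algebra.
From mathcomp Require Import classical_sets reals convex.

Set Implicit Arguments.
Unset Strict Implicit.
Unset Printing Implicit Defensive.

Import Order.TTheory GRing.Theory Num.Theory.

Local Open Scope classical_set_scope.
Local Open Scope ring_scope.

(* Parallel edges are allowed: distinct edges may have the same endpoints.
   Loops are excluded by [card_ends]. *)
Record multigraph := Multigraph {
  vertex : finType;
  edge : finType;
  ends : edge -> {set vertex};
  card_ends : forall e, #|ends e| = 2%N }.

(* [o e = (u, v)] means that the edge [e], with endpoints [u] and [v], is
   oriented from [u] to [v]. *)
Definition orientation (G : multigraph)
    (o : {ffun edge G -> vertex G * vertex G}) : Prop :=
  forall e, [set (o e).1; (o e).2]%SET = ends e.

Definition indegree (G : multigraph)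
    (o : {ffun edge G -> vertex G * vertex G}) (v : vertex G) : nat :=
  #|[set e | (o e).2 == v]%SET|.

(* For a finite type T, the space R^T is represented by 'cV[R]_#|T|: the
   coordinate at t : T has index [enum_rank t], and conversely index i stands
   for [enum_val i : T]. *)
Definition indegree_vector (R : realType) (G : multigraph)
    (o : {ffun edge G -> vertex G * vertex G}) : 'cV[R]_#|vertex G| :=
  \col_i (indegree o (enum_val i))%:R.

Definition convex_hull (R : realType) (M : lmodType R) (A : set M) : set M :=
  smallest (@convex_set R M) A.

Definition indegree_polytope (R : realType) (G : multigraph) :
    set 'cV[R]_#|vertex G| :=
  convex_hull [set indegree_vector R o | o in @orientation G].

Arguments indegree_polytope : clear implicits.

Definition incidence_edge (G : multigraph) : finType :=
  {ev : edge G * vertex G | ev.2 \in ends ev.1}.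

Definition incidence_ends (G : multigraph) (f : incidence_edge G) :
    {set vertex G + edge G} :=
  [set inl (val f).2; inr (val f).1]%SET.

Lemma card_incidence_ends (G : multigraph) (f : incidence_edge G) :
  #|incidence_ends f| = 2%N.
Proof. by rewrite cards2. Qed.

(* The bipartite graph G' = (V, E; E'), on the disjoint union of V and E. *)
Definition incidence_graph (G : multigraph) : multigraph :=
  Multigraph (@card_incidence_ends G).

Section System.
Variables (R : realType) (G : multigraph).

Local Notation nV := #|vertex G|.
Local Notation nE := #|edge G|.
Local Notation nE' := #|edge (incidence_graph G)|.

(* The rows indexed by V come first, followed by those indexed by E. *)
Definition row_vertex (i : 'I_(nV + nE)) : vertex (incidence_graph G) :=
  match split i with
  | inl k => inl (enum_val k)
  | inr k => inr (enum_val k)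
  end.

Definition incidence_mx : 'M[R]_(nV + nE, nE') :=
  \matrix_(i, j) (row_vertex i \in ends (enum_val j))%:R.

Definition system_mx : 'M[R]_(nV + nE, nE' + nV) :=
  row_mx incidence_mx (col_mx (- 1%:M) 0).

Definition system_rhs : 'cV[R]_(nV + nE) := col_mx 0 (const_mx 1).

Definition nonneg_orthant (n : nat) : set 'cV[R]_n :=
  [set z | forall i, 0 <= z i 0].

Definition system_polytope : set ('cV[R]_nE' * 'cV[R]_nV) :=
  [set yx | [/\ nonneg_orthant yx.1, nonneg_orthant yx.2 &
             system_mx *m col_mx yx.1 yx.2 = system_rhs]].

Definition system_projection : set 'cV[R]_nV :=
  [set x | nonneg_orthant x /\
           exists2 y, nonneg_orthant y & system_polytope (y, x)].

End System.

Arguments system_polytope : clear implicits.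
Arguments system_projection : clear implicits.

(* Main.v *)
Require Import Defs.
From mathcomp Require Import all_boot all_order all_algebra.
From mathcomp Require Import interval_inference.
From mathcomp Require Import classical_sets reals convex.

(** The points of P are the fractional orientations of G: each edge is shared
    between its two endpoints, and x collects the shares received by each
    vertex. Such points form a convex set containing the orientations.
    Conversely, a fractional orientation in which e = uv gives the share t to u
    is the combination, with weights t and 1 - t, of the fractional orientations
    obtained from it by directing e to u and to v; resolving the edges one after
    the other, x ends up in every convex set that contains the indegree vectors. *)

Set Implicit Arguments.
Unset Strict Implicit.
Unset Printing Implicit Defensive.

Import Order.TTheory GRing.Theory Num.Theory.

Local Open Scope classical_set_scope.
Local Open Scope ring_scope.

(** Unbundles the weight: [convex_set] quantifies over elements of the unit interval type, here
    replaced by a scalar with two inequalities. *)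
Lemma convex_setP (R : numDomainType) (M : lmodType R) (A : set M) :
  @convex_set R M A <->
  forall x y t, A x -> A y -> 0 <= t -> t <= 1 -> A (t *: x + (1 - t) *: y).
Proof.
split=> [cA x y t Ax Ay t_ge0 t_le1 | cA x y t].
  have := cA x y (Itv01 t_ge0 t_le1); rewrite !in_setE; exact.
by rewrite !in_setE => Ax Ay; apply: cA; rewrite ?ge0 ?le1.
Qed.

(** * Fractional orientations and their indegree vectors *)

Section FractionalOrientation.
Variables (R : realType) (G : multigraph).
Implicit Types (e : edge G) (u v : vertex G) (w : edge G -> vertex G -> R).

(** Shares are total functions on pairs, zero off the incidences, so that sums can range over all
    vertices or all edges. *)
Definition fractional_orientation w : Prop :=
  [/\ forall e v, 0 <= w e v,
      forall e v, v \notin ends e -> w e v = 0 &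
      forall e, \sum_v w e v = 1].

Definition fractional_indegree w : 'cV[R]_#|vertex G| :=
  \col_i \sum_e w e (enum_val i).

Definition orient_edge w e u : edge G -> vertex G -> R :=
  fun f v => if f == e then (v == u)%:R else w f v.

Lemma sum_pred1_natr (T : finType) (u : T) :
  \sum_v ((v == u)%:R : R) = 1.
Proof.
by rewrite (bigD1 u) //= eqxx big1 ?addr0 // => v /negPf->.
Qed.

Lemma orient_edge_fractional w e u :
  fractional_orientation w -> u \in ends e ->
  fractional_orientation (orient_edge w e u).
Proof.
case=> w_ge0 w_out w_sum eu; rewrite /orient_edge; split=> [f v|f v|f].
- by case: eqP.
- case: eqP => [->|_]; last exact: w_out.
  by have [->|] := eqVneq v u; rewrite ?eu.
- by case: eqP => [_|_]; [exact: sum_pred1_natr | exact: w_sum].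
Qed.

Lemma fractional_orientation_convex w1 w2 t :
  fractional_orientation w1 -> fractional_orientation w2 ->
  0 <= t -> t <= 1 ->
  fractional_orientation (fun e v => t * w1 e v + (1 - t) * w2 e v).
Proof.
move=> [w1_ge0 w1_out w1_sum] [w2_ge0 w2_out w2_sum] t_ge0 t_le1.
split=> [e v|e v ev|e].
- by rewrite addr_ge0 ?mulr_ge0 ?subr_ge0.
- by rewrite w1_out ?w2_out // !mulr0 addr0.
- by rewrite big_split -!mulr_sumr w1_sum w2_sum !mulr1 /= addrC subrK.
Qed.

Lemma fractional_indegree_convex w1 w2 t :
  fractional_indegree (fun e v => t * w1 e v + (1 - t) * w2 e v) =
  t *: fractional_indegree w1 + (1 - t) *: fractional_indegree w2.
Proof. by apply/matrixP=> i j; rewrite !mxE big_split -!mulr_sumr. Qed.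

(** The shares of [e] live on its two ends, so they form a convex combination of two unit vectors;
    all other edges are left alone. *)
Lemma fractional_indegree_split w e :
  fractional_orientation w ->
  exists u v t, [/\ u \in ends e, v \in ends e, 0 <= t, t <= 1 &
    fractional_indegree w =
      t *: fractional_indegree (orient_edge w e u) +
      (1 - t) *: fractional_indegree (orient_edge w e v)].
Proof.
move=> [w_ge0 w_out w_sum].
have /eqP/cards2P[u [v [uv eE]]] := card_ends e.
have w_uv : w e u + w e v = 1.
  rewrite -(w_sum e) (bigD1 u) //= (bigD1 v) 1?eq_sym //=.
  rewrite big1 ?addr0 // => z /andP[zu zv].
  by rewrite w_out // eE !inE negb_or zu zv.
exists u, v, (w e u); split=> //; rewrite ?eE ?inE ?eqxx ?orbT //.
  by rewrite -w_uv lerDl.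
have -> : 1 - w e u = w e v by rewrite -w_uv addrAC subrr add0r.
apply/matrixP=> i j; rewrite !mxE !mulr_sumr -big_split.
apply: eq_bigr => f _ /=; rewrite /orient_edge.
(* For [f] other than [e] both terms carry the same share and the weights add up to 1; for [e] the
   vertex is [u], [v], or not an end. *)
have [->|_] := eqVneq f e; last by rewrite -mulrDl w_uv mul1r.
have [->|iu] := eqVneq (enum_val i) u; first by rewrite (negPf uv) mulr1 mulr0 addr0.
have [->|iv] := eqVneq (enum_val i) v; first by rewrite mulr1 mulr0 add0r.
by rewrite !mulr0 addr0 w_out // eE !inE negb_or iu iv.
Qed.

(** * Integral fractional orientations and the convex hull *)

Definition head_indicator (o : {ffun edge G -> vertex G * vertex G}) :
    edge G -> vertex G -> R :=
  fun e v => (v == (o e).2)%:R.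

Lemma indegree_vectorE o :
  indegree_vector R o = fractional_indegree (head_indicator o).
Proof.
apply/matrixP=> i j; rewrite !mxE -natr_sum /indegree -sum1_card.
rewrite big_mkcond; congr (_%:R); apply: eq_bigr => e _ /=.
by rewrite inE eq_sym; case: ifP.
Qed.

Lemma head_indicator_fractional o :
  orientation o -> fractional_orientation (head_indicator o).
Proof.
move=> oP; split=> [e v|e v|e] //; last exact: sum_pred1_natr.
rewrite -oP !inE negb_or => /andP[_ /negPf].
by rewrite /head_indicator => ->.
Qed.

(** A share of 1 exhausts its edge, so [w] is the head indicator of an orientation. *)
Lemma integral_fractional_indegree w :
  fractional_orientation w -> (forall e, exists v, w e v = 1) ->
  exists2 o, orientation o & fractional_indegree w = indegree_vector R o.
Proof.
move=> [w_ge0 w_out w_sum] w_int.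
have /fin_all_exists[o oP] e :
    exists p : vertex G * vertex G, [set p.1; p.2]%SET = ends e /\ w e p.2 = 1.
  have [v wv] := w_int e.
  have ev : v \in ends e.
    apply: contraT => /w_out; rewrite wv => /eqP; by rewrite oner_eq0.
  (* The two ends come in arbitrary order; the one with share 1 must be the second component, the
     head. *)
  have /eqP/cards2P[a [b [_ eE]]] := card_ends e.
  move: ev; rewrite eE !inE => /orP[]/eqP vE; subst v.
    by exists (b, a); rewrite finset.setUC.
  by exists (a, b).
exists (finfun o) => [e|]; first by rewrite ffunE; case: (oP e).
rewrite indegree_vectorE; apply/matrixP=> i j; rewrite !mxE.
apply: eq_bigr => e _; rewrite /head_indicator ffunE; have [_ we] := oP e.
have [-> //|ne] := eqVneq (enum_val i) (o e).2.
(* The shares away from the head are nonnegative with sum 0, hence all zero. *)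
have /eqP := w_sum e; rewrite (bigD1 (o e).2) //= we addrC -subr_eq0 addrK.
rewrite psumr_eq0 // => /allP/(_ (enum_val i)).
by rewrite mem_index_enum ne => /(_ isT)/eqP.
Qed.

Lemma fractional_indegree_in_convex (D : set 'cV[R]_#|vertex G|) w :
  @convex_set R _ D -> [set indegree_vector R o | o in @orientation G] `<=` D ->
  fractional_orientation w -> D (fractional_indegree w).
Proof.
move=> /convex_setP cD sD w_frac.
(* Induction invariant: each edge is still listed or already gives all of itself to one vertex. Once
   the list is empty, [w] is integral. *)
have: forall e, e \in enum (edge G) \/ exists v, w e v = 1.
  by move=> e; left; rewrite mem_enum.
elim: (enum _) w w_frac => [|e s IH] w w_frac ws.
  have [|o oP ->] := integral_fractional_indegree w_frac.
    by move=> e; case: (ws e).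
  by apply: sD; exists o.
have [u [v [t [eu ev t_ge0 t_le1 ->]]]] := fractional_indegree_split e w_frac.
have oriented z : z \in ends e -> D (fractional_indegree (orient_edge w e z)).
  move=> ez; apply: IH => [|f]; first exact: orient_edge_fractional.
  rewrite /orient_edge; have [_|fe] := eqVneq f e.
    by right; exists z; rewrite eqxx.
  by have := ws f; rewrite inE (negPf fe).
by apply: cD => //; apply: oriented.
Qed.

(** The hull is the intersection of the convex sets containing the indegree vectors: one inclusion
    is checked in each such set, the other holds because the left side is one of them. *)
Lemma fractional_indegree_hull :
  [set fractional_indegree w | w in fractional_orientation] =
  indegree_polytope R G.
Proof.
apply/seteqP; split=> [_ [w w_frac <-] D [cD sD]|].
  exact: fractional_indegree_in_convex.
apply: smallest_sub.
  apply/convex_setP => _ _ t [w1 w1P <-] [w2 w2P <-] t_ge0 t_le1.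
  exists (fun e v => t * w1 e v + (1 - t) * w2 e v).
    exact: fractional_orientation_convex.
  exact: fractional_indegree_convex.
move=> _ [o oP <-]; exists (head_indicator o).
  exact: head_indicator_fractional.
by rewrite indegree_vectorE.
Qed.

(** * From sums over incidences to the linear system *)

Lemma sum_incidence_edge w :
  (forall e v, v \notin ends e -> w e v = 0) ->
  \sum_(f : incidence_edge G) w (val f).1 (val f).2 = \sum_e \sum_v w e v.
Proof.
move=> w_out; rewrite pair_bigA /=.
(* The sum over the subtype becomes a sum over all pairs, whose extra terms vanish by [w_out]. *)
rewrite -(big_sub (fun p : edge G * vertex G => p.2 \in ends p.1)
            (fun p => w p.1 p.2)) big_mkcond.
by apply: eq_bigr => -[e v] _; rewrite unfold_in /=; case: ifPn => // /w_out.
Qed.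

Lemma sum_incidence_at_vertex w v :
  (forall e v, v \notin ends e -> w e v = 0) ->
  \sum_(f : incidence_edge G) (v == (val f).2)%:R * w (val f).1 (val f).2 =
  \sum_e w e v.
Proof.
move=> w_out.
rewrite (sum_incidence_edge (w := fun e u => (v == u)%:R * w e u)); last first.
  by move=> e u eu; rewrite w_out // mulr0.
apply: eq_bigr => e _; rewrite (bigD1 v) //= eqxx mul1r.
by rewrite big1 ?addr0 // => u uv; rewrite eq_sym (negPf uv) mul0r.
Qed.

Lemma sum_incidence_at_edge w e :
  (forall e v, v \notin ends e -> w e v = 0) ->
  \sum_(f : incidence_edge G) (e == (val f).1)%:R * w (val f).1 (val f).2 =
  \sum_v w e v.
Proof.
move=> w_out.
rewrite (sum_incidence_edge (w := fun f v => (e == f)%:R * w f v)); last first.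
  by move=> f v fv; rewrite w_out // mulr0.
rewrite (bigD1 e) //= [X in _ + X]big1 ?addr0 => [|f fe].
  by apply: eq_bigr => v _; rewrite eqxx mul1r.
by rewrite big1 // => v _; rewrite eq_sym (negPf fe) mul0r.
Qed.

(** Reads the block equation row by row: the negated identity moves [x] to the right of the vertex
    rows, and the zero block removes it from the edge rows. *)
Lemma system_mxE (y : 'cV[R]_#|edge (incidence_graph G)|) x :
  system_mx R G *m col_mx y x = system_rhs R G <->
  (forall v, \sum_(f : incidence_edge G) (v == (val f).2)%:R * y (enum_rank f) 0
             = x (enum_rank v) 0) /\
  (forall e, \sum_(f : incidence_edge G) (e == (val f).1)%:R * y (enum_rank f) 0
             = 1).
Proof.
have prodE i : (incidence_mx R G *m y) i 0 =
    \sum_(f : incidence_edge G) (row_vertex i \in incidence_ends f)%:R *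
      y (enum_rank f) 0.
  rewrite mxE (reindex (@enum_val (edge (incidence_graph G)) predT)) /=.
    by apply: eq_bigr => j _; rewrite mxE enum_valK.
  exact/onW_bij/enum_val_bij.
have rowV v : row_vertex (lshift _ (enum_rank v)) = inl v :> vertex (incidence_graph G).
  by rewrite /row_vertex (unsplitK (inl _)) enum_rankK.
have rowE e : row_vertex (rshift _ (enum_rank e)) = inr e :> vertex (incidence_graph G).
  by rewrite /row_vertex (unsplitK (inr _)) enum_rankK.
have prodV v : (incidence_mx R G *m y) (lshift _ (enum_rank v)) 0 =
    \sum_(f : incidence_edge G) (v == (val f).2)%:R * y (enum_rank f) 0.
  by rewrite prodE rowV; apply: eq_bigr => f _; rewrite !inE orbF.
have prodR e : (incidence_mx R G *m y) (rshift _ (enum_rank e)) 0 =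
    \sum_(f : incidence_edge G) (e == (val f).1)%:R * y (enum_rank f) 0.
  by rewrite prodE rowE; apply: eq_bigr => f _; rewrite !inE.
rewrite /system_mx /system_rhs mul_row_col mul_col_mx mul0mx mulNmx mul1mx.
split=> [/matrixP sys|[sysV sysE]].
  split=> [v|e].
    have /eqP := sys (lshift _ (enum_rank v)) 0.
    by rewrite mxE !col_mxEu prodV !mxE subr_eq0 => /eqP.
  have := sys (rshift _ (enum_rank e)) 0.
  by rewrite mxE !col_mxEd prodR !mxE addr0.
apply/matrixP=> i j; rewrite (ord1 j) mxE.
case: (split_ordP i) => k ->; rewrite -(enum_valK k).
  by rewrite !col_mxEu prodV sysV !mxE subrr.
by rewrite !col_mxEd prodR sysE !mxE addr0.
Qed.

(** Extension by zero and restriction to incidences translate between [y] and [w]. *)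
Lemma system_projection_fractional :
  system_projection R G =
  [set fractional_indegree w | w in fractional_orientation].
Proof.
apply/seteqP; split=> [x [_ [y y_ge0 [_ _ /system_mxE[/= sysV sysE]]]]|].
  (* [insub] tests incidence; the default 0 gives the support condition. *)
  pose w e v := if insub (e, v) is Some f
    then y (enum_rank (f : incidence_edge G)) 0 else 0.
  have w_out e v : v \notin ends e -> w e v = 0.
    by move=> ev; rewrite /w insubN.
  have wE (f : incidence_edge G) : w (val f).1 (val f).2 = y (enum_rank f) 0.
    by rewrite /w -surjective_pairing valK.
  exists w.
    split=> // [e v|e]; first by rewrite /w; case: insub.
    rewrite -(sum_incidence_at_edge _ w_out) -[RHS](sysE e).
    by apply: eq_bigr => f _; rewrite wE.
  apply/matrixP=> i j; rewrite (ord1 j) mxE -{2}(enum_valK i) -sysV.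
  rewrite -(sum_incidence_at_vertex _ w_out).
  by apply: eq_bigr => f _; rewrite wE.
move=> _ [w [w_ge0 w_out w_sum] <-].
have x_ge0 : nonneg_orthant (fractional_indegree w).
  by move=> i; rewrite mxE sumr_ge0.
pose y : 'cV[R]_#|edge (incidence_graph G)| :=
  \col_j w (val (enum_val j : incidence_edge G)).1
           (val (enum_val j : incidence_edge G)).2.
have y_ge0 : nonneg_orthant y by move=> j; rewrite mxE.
split=> //; exists y => //; split=> //; apply/system_mxE; split=> [v|e].
  under eq_bigr do rewrite mxE enum_rankK.
  by rewrite sum_incidence_at_vertex // mxE enum_rankK.
under eq_bigr do rewrite mxE enum_rankK.
by rewrite sum_incidence_at_edge.
Qed.

End FractionalOrientation.

Theorem theorem2 (R : realType) (G : multigraph) :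
  system_projection R G = indegree_polytope R G.
Proof. by rewrite system_projection_fractional fractional_indegree_hull. Qed.
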